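(* There exists a universal constant $C>0$ such that the following holds. Let $B\subset\mathbb{R}^d$ be the Euclidean unit ball, $R_1,\ldots,R_k\in\mathbb{R}$, and for $i\in\{1,\ldots,k\}$ let $A_i$ be the class of $R_i$-bounded affine functions on $B$, $$A_i=\{x\mapsto w\cdot x+b\ :\ w\in\mathbb{R}^d,\ b\in\mathbb{R},\ \max\{\|w\|,|b|\}\le R_i\}.$$ Suppose that either $F_i=A_i$ for all $i$ (classes on the domain $B$), or $F_i=\{(x,y)\mapsto\max\{0,1-yf(x)\}: f\in A_i\}$ for all $i$ (hinge-loss affine classes on the domain $B\times\{-1,1\}$). Let $G_{\max}(x_1,\ldots,x_k)=\max_{i}x_i$ be the maximum aggregation rule and let $\tilde R=\max_i R_i$. Then $$\mathcal{R}_n(G_{\max}(F_1,\ldots,F_k))\le C\sqrt{\frac{\mathrm{Log}(k)\,\log^3(\tilde R n)\,\tilde R^2\sum_{i=1}^k R_i^2}{n}},$$ where $\mathcal{R}_n$ is the Rademacher complexity.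
   Context: $\|\cdot\|$ is the Euclidean norm, $\log$ is the natural logarithm and $\mathrm{Log}(x):=\log(\max\{e,x\})$. For classes $F_1,\ldots,F_k$ of real-valued functions on a common domain, $$G_{\max}(F_1,\ldots,F_k):=\{x\mapsto \max_{i} f_i(x) : f_i\in F_i,\ i\in\{1,\ldots,k\}\}.$$ Rademacher complexity: for a class $\mathcal{F}$ of real-valued functions on $\mathcal{W}$ and $(w_1,\ldots,w_n)\in\mathcal{W}^n$, the empirical Rademacher complexity is $$\mathcal{R}_n(\mathcal{F}\mid w_1,\ldots,w_n)=\mathbb{E}_\sigma\sup_{f\in\mathcal{F}}\frac1n\sum_{i=1}^n\sigma_i f(w_i),$$ where $\sigma_1,\ldots,\sigma_n$ are independent and uniform on $\{-1,1\}$. With respect to a distribution $\mathcal{D}$ on $\mathcal{W}$, $\mathcal{R}_n(\mathcal{F})=\mathbb{E}_{w_1,\ldots,w_n\sim\mathcal{D}}\,\mathcal{R}_n(\mathcal{F}\mid w_1,\ldots,w_n)$ (with $w_1,\dots,w_n$ i.i.d.). The bound is for an arbitrary distribution $\mathcal{D}$ on the domain.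
   Formalization: The bound is proved under the added assumptions R̃ ≥ 1 and R̃n ≥ 2; without them it fails, e.g. k = n = 1, R_1 = 1 makes the right-hand side 0 while the complexity is at least 1, and for R̃ → 0 with n ≈ 4/R̃ no universal C works. *)

(* Defs.v *)
From HB Require Import structures.
From mathcomp Require Import all_boot all_order all_algebra.
From mathcomp Require Import all_classical all_reals all_analysis.
Import Order.TTheory GRing.Theory Num.Theory.
Import numFieldNormedType.Exports.

Set Implicit Arguments.
Unset Strict Implicit.
Unset Printing Implicit Defensive.

Local Open Scope classical_set_scope.
Local Open Scope ring_scope.

Definition dotp (R : realType) (d : nat) (w x : 'rV[R]_d) : R :=
  \sum_(j < d) w 0 j * x 0 j.

(* Needed because [`|x|] on ['rV[R]_d] is the sup norm. *)
Definition enorm (R : realType) (d : nat) (x : 'rV[R]_d) : R :=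
  Num.sqrt (dotp x x).

Definition Log (R : realType) (x : R) : R := ln (Num.max (expR 1) x).

(* The family is nonempty and takes values of any sign, so the fold starts from
   one of its members. *)
Definition max_agg (R : realType) (k : nat) (x : 'I_k.+1 -> R) : R :=
  \big[Num.max/x ord0]_(i < k.+1) x i.

Definition Gmax (R : realType) (W : Type) (k : nat)
    (F : 'I_k.+1 -> set (W -> R)) : set (W -> R) :=
  [set g | exists2 f : 'I_k.+1 -> W -> R,
     (forall i, F i (f i)) & g = fun x => max_agg (fun i => f i x)].

Definition eball_set (R : realType) (d : nat) : {pred 'rV[R]_d} :=
  [pred x | enorm x <= 1].

Definition eball (R : realType) (d : nat) : Type :=
  {x : 'rV[R]_d | x \in @eball_set R d}.

Section eball_instances.
Context (R : realType) (d : nat).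

Lemma eball0 : 0 \in @eball_set R d.
Proof.
by rewrite inE /enorm /dotp big1 ?sqrtr0// => j _; rewrite mxE mul0r.
Qed.

HB.instance Definition _ := Choice.on (eball R d).
HB.instance Definition _ := isPointed.Build (eball R d) (exist _ 0 eball0).

End eball_instances.

Definition eball_val (R : realType) (d : nat) (x : eball R d) :
  g_sigma_algebraType (@open 'rV[R]_d) := sval x.

(* The ball with the trace of the Borel sigma-algebra of R^d. *)
Notation borel_eball R d := (g_sigma_algebra_preimageType (@eball_val R d)).

Section power_probability.
Context (dW : measure_display) (W : measurableType dW) (R : realType).

Definition tcons (n : nat) (x : W * n.-tuple W) : n.+1.-tuple W :=
  [tuple of x.1 :: x.2].

Lemma measurable_tcons (n : nat) : measurable_fun setT (@tcons n).
Proof. exact: measurable_cons. Qed.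

HB.instance Definition _ (n : nat) :=
  isMeasurableFun.Build _ _ _ _ (@tcons n) (@measurable_tcons n).

(* [power_probability D n] is the n-fold product measure of D, i.e. the joint
   law of n independent draws from D. *)
Fixpoint power_probability (D : probability W R) (n : nat) :
    probability (n.-tuple W) R :=
  match n with
  | 0 => \d_([tuple] : 0.-tuple W)
  | m.+1 => distribution (D \x power_probability D m)%E (@tcons m)
  end.

End power_probability.

(* Signs in {-1, 1} are encoded by booleans b, as (-1) ^+ b. *)
Definition sgb (R : realType) (b : bool) : R := (-1) ^+ b.

(* The expectation over the n signs is the average over the 2 ^ n sign
   patterns.  The supremum is taken in \bar R, so it is never truncated by a
   default value (it is -oo when the class is empty). *)
Definition emp_rademacher (R : realType) (W : Type) (F : set (W -> R))
    (n : nat) (w : n.-tuple W) : \bar R :=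
  (((2 ^+ n)^-1)%:E *
   \sum_(s : {ffun 'I_n -> bool})
     ereal_sup [set ((n%:R)^-1 * \sum_(i < n) sgb R (s i) * f (tnth w i))%:E
               | f in F])%E.

Definition rademacher (R : realType) (dW : measure_display)
    (W : measurableType dW) (D : probability W R) (F : set (W -> R))
    (n : nat) : \bar R :=
  (\int[power_probability D n]_w emp_rademacher F w)%E.

Definition affine_class (R : realType) (d : nat) (r : R) :
    set (eball R d -> R) :=
  [set f | exists w : 'rV[R]_d, exists2 b : R,
     Num.max (enorm w) `|b| <= r & f = fun x => dotp w (sval x) + b].

Definition hinge (R : realType) (X : Type) (f : X -> R) (xy : X * bool) : R :=
  Num.max 0 (1 - sgb R xy.2 * f xy.1).

Definition hinge_class (R : realType) (d : nat) (r : R) :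
    set (eball R d * bool -> R) :=
  [set hinge f | f in @affine_class R d r].

(* Main.v *)
(** Fix the sample.  The maximum of affine functions, or of their hinge losses,
is a map of the joint vector of all values [w_i . x_t + b_i] that is
1-Lipschitz for the sup norm, so it suffices to cover these vectors in sup
norm.  They are the inner products of one parameter vector, of squared norm at
most [2 S] with [S = sum_i r_i^2], with [k n] features of squared norm at most
[2].  Running the perceptron on all the features at once shows that [4 S / e^2]
corrections, each chosen among [2 k n] signed features, approximate them within
[e]: the sup-norm entropy at scale [e] is [O(S log (k n) / e^2)].  In Dudley's
chaining every dyadic scale then contributes the same
[O(sqrt (S log (k n) / n))], and [O(log n)] scales are enough. *)

Require Import Defs.
From HB Require Import structures.
From mathcomp Require Import all_boot all_order all_algebra.
From mathcomp Require Import all_classical all_reals all_analysis.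
From mathcomp Require Import ring lra.
Import Order.TTheory GRing.Theory Num.Theory.
Import numFieldNormedType.Exports.

Set Implicit Arguments.
Unset Strict Implicit.
Unset Printing Implicit Defensive.

Local Open Scope classical_set_scope.
Local Open Scope ring_scope.

(** * Random signs: exponential moments, finite maxima, chaining *)

(** The non-sharp factor 2 allows an elementary proof. For [0 <= x <= 1/2], invert
    [1 - x <= expR (- x)] and [1 + x <= expR x], using [(1 + x + 2x^2)(1 - x) = 1 + x^2 (1 - 2x)];
    beyond [1/2], already [x <= 2x^2]. *)
Lemma cosh_le_expR (R : realType) (x : R) :
  (expR x + expR (- x)) / 2 <= expR (2 * x ^+ 2).
Proof.
wlog x0 : x / 0 <= x => [H|].
  have [/H//|/ltW x0] := leP 0 x.
  by have := H (- x); rewrite oppr_ge0 opprK sqrrN addrC => /(_ x0).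
have [x1|/ltW x1] := leP x (1 / 2).
  have := expR_ge1Dx (2 * x ^+ 2).
  have hp : expR x * (1 - x) <= 1.
    rewrite -[leRHS](expRxMexpNx_1 x) ler_wpM2l ?expR_ge0//.
    exact: expR_ge1Dx.
  have hm : expR (- x) * (1 + x) <= 1.
    rewrite -[leRHS](expRxMexpNx_1 x) mulrC ler_wpM2r ?expR_ge0//.
    exact: expR_ge1Dx.
  have hp2 : expR x <= 1 + x + 2 * x ^+ 2.
    have h1 : 0 < 1 - x by lra.
    have : 1 <= (1 + x + 2 * x ^+ 2) * (1 - x) by nra.
    by move=> /(le_trans hp); rewrite ler_pM2r.
  have hm2 : expR (- x) <= 1 - x + x ^+ 2.
    have h1 : 0 < 1 + x by lra.
    have : 1 <= (1 - x + x ^+ 2) * (1 + x) by nra.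
    by move=> /(le_trans hm); rewrite ler_pM2r.
  nra.
have h1 : expR (- x) <= expR x by rewrite ler_expR; lra.
have h2 : expR x <= expR (2 * x ^+ 2) by rewrite ler_expR; nra.
lra.
Qed.

Definition signmean (R : realType) (n : nat)
    (Psi : {ffun 'I_n -> bool} -> R) : R := (2 ^+ n)^-1 * \sum_s Psi s.

Definition signsum (R : realType) (n : nat) (s : {ffun 'I_n -> bool})
    (v : 'I_n -> R) : R := \sum_(t < n) sgb R (s t) * v t.

Section signs.
Context (R : realType) (n : nat).
Implicit Types (s : {ffun 'I_n -> bool}) (v : 'I_n -> R)
  (Psi : {ffun 'I_n -> bool} -> R).

Lemma signmean_cst (c : R) : signmean (fun _ : {ffun 'I_n -> bool} => c) = c.
Proof.
rewrite /signmean sumr_const card_ffun card_bool card_ord.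
rewrite -[c *+ _]mulr_natl mulrA.
by rewrite natrX mulVf ?mul1r// expf_neq0// pnatr_eq0.
Qed.

Lemma signmeanD Psi1 Psi2 :
  signmean (fun s => Psi1 s + Psi2 s) = signmean Psi1 + signmean Psi2.
Proof. by rewrite /signmean big_split mulrDr. Qed.

Lemma signmeanZ (c : R) Psi : signmean (fun s => c * Psi s) = c * signmean Psi.
Proof. by rewrite /signmean -mulr_sumr mulrCA. Qed.

Lemma signmean_sum (I : finType) (Psi : I -> {ffun 'I_n -> bool} -> R) :
  signmean (fun s => \sum_i Psi i s) = \sum_i signmean (Psi i).
Proof. by rewrite /signmean exchange_big mulr_sumr. Qed.

(** Independence of the signs, in the form of distributivity of products over sums. *)
Lemma signmean_prod (F : 'I_n -> bool -> R) :
  signmean (fun s => \prod_t F t (s t)) = \prod_t ((F t true + F t false) / 2).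
Proof.
rewrite /signmean -bigA_distr_bigA mulrC -exprVn.
under eq_bigr do rewrite big_bool.
by rewrite big_split/= prodr_const card_ord.
Qed.

Lemma sgbE (b : bool) : sgb R b = if b then -1 else 1.
Proof. by case: b; rewrite /sgb ?expr1 ?expr0. Qed.

Lemma norm_sgb (b : bool) : `|sgb R b| = 1.
Proof. by case: b; rewrite sgbE ?normrN normr1. Qed.

Lemma signmean_expR_signsum v (lam B : R) : (forall t, `|v t| <= B) ->
  signmean (fun s => expR (lam * signsum s v))
    <= expR (2 * lam ^+ 2 * n%:R * B ^+ 2).
Proof.
move=> vB.
rewrite (_ : (fun s => _) =
    fun s => \prod_t expR (lam * (sgb R (s t) * v t))); last first.
  by apply/funext => s; rewrite /signsum mulr_sumr expR_sum.
rewrite (signmean_prod (fun t b => expR (lam * (sgb R b * v t)))).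
apply: (@le_trans _ _ (\prod_(t < n) expR (2 * lam ^+ 2 * B ^+ 2))); last first.
  rewrite prodr_const card_ord -expRM_natl// ler_expR le_eqVlt; apply/orP; left.
  by apply/eqP; ring.
apply: ler_prod => t _; rewrite divr_ge0 ?addr_ge0 ?expR_ge0//=.
rewrite !sgbE mul1r mulN1r mulrN addrC.
apply: (le_trans (cosh_le_expR _)); rewrite ler_expR exprMn mulrA.
rewrite ler_wpM2l//; first by rewrite mulr_ge0// sqr_ge0.
rewrite -(real_normK (num_real (v t))).
by rewrite lerXn2r ?nnegrE// (le_trans (normr_ge0 _) (vB t)).
Qed.

(** By symmetry: flipping every sign permutes the patterns and negates the sum. *)
Lemma signmean_signsum v : signmean (fun s => signsum s v) = 0.
Proof.
pose neg s : {ffun 'I_n -> bool} := [ffun t => ~~ s t].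
have negK : involutive neg by move=> s; apply/ffunP => t; rewrite !ffunE negbK.
suff : signmean (fun s => signsum s v) =
       - signmean (fun s => signsum s v) by lra.
rewrite {1}/signmean (reindex_inj (inv_inj negK))/= /signmean -mulrN -sumrN.
congr (_ * _); apply: eq_bigr => s _; rewrite /signsum -sumrN.
by apply: eq_bigr => t _; rewrite !ffunE !sgbE; case: (s t) => /=; lra.
Qed.

(* [1 + y <= expR y] at [y = lam * X - A], with [A] chosen so that the
   exponential has mean at most [1]: no Jensen inequality is needed. *)
Lemma massart (P : finType) (D : P -> 'I_n -> R) (B lam : R) :
  (0 < #|P|)%N -> (forall p t, `|D p t| <= B) -> 0 < lam ->
  exists2 Psi, (forall s p, signsum s (D p) <= Psi s) &
    signmean Psi <= ln #|P|%:R / lam + 2 * lam * n%:R * B ^+ 2.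
Proof.
move=> P0 DB lam0; pose A := ln #|P|%:R + 2 * lam ^+ 2 * n%:R * B ^+ 2.
exists (fun s => lam^-1 * (A - 1 + expR (- A) *
                   \sum_p expR (lam * signsum s (D p)))).
  move=> s p; rewrite -(ler_pM2l lam0) mulVKf ?gt_eqF//.
  have h : expR (lam * signsum s (D p) - A) <=
           expR (- A) * \sum_p expR (lam * signsum s (D p)).
    rewrite addrC expRD ler_wpM2l ?expR_ge0// (bigD1 p)//= lerDl.
    by apply: sumr_ge0 => *; exact: expR_ge0.
  by have := expR_ge1Dx (lam * signsum s (D p) - A); lra.
rewrite signmeanZ signmeanD signmean_cst signmeanZ signmean_sum.
have -> : ln #|P|%:R / lam + 2 * lam * n%:R * B ^+ 2 = lam^-1 * A.
  by rewrite /A; field; rewrite gt_eqF.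
rewrite ler_pM2l ?invr_gt0//.
(* [expR A] is exactly [#|P|] times the moment bound of [signmean_expR_signsum]. *)
suff : expR (- A) *
    \sum_p signmean (fun s => expR (lam * signsum s (D p))) <= 1.
  by lra.
rewrite -(expRxMexpNx_1 A) mulrC ler_wpM2r ?expR_ge0// /A expRD lnK; last first.
  by rewrite posrE ltr0n.
apply: (@le_trans _ _ (\sum_(p : P) expR (2 * lam ^+ 2 * n%:R * B ^+ 2))).
  by apply: ler_sum => p _; apply: signmean_expR_signsum.
by rewrite sumr_const -[X in X <= _]mulr_natl.
Qed.

Lemma signsumB s v1 v2 :
  signsum s (fun t => v1 t - v2 t) = signsum s v1 - signsum s v2.
Proof.
by rewrite /signsum -sumrB; apply: eq_bigr => t _; rewrite mulrBr.
Qed.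

Lemma signsum_le s v (e : R) :
  (forall t, `|v t| <= e) -> signsum s v <= n%:R * e.
Proof.
move=> ve; have -> : n%:R * e = \sum_(t < n) e.
  by rewrite sumr_const card_ord mulr_natl.
apply: ler_sum => t _; apply: le_trans (ve t); apply: le_trans (ler_norm _) _.
by rewrite normrM norm_sgb mul1r.
Qed.

(* [h j] decodes a word over [X] into an approximation at scale [eps j]. *)
Lemma chaining (X : finType) (J : nat) (m : nat -> nat)
    (h : nat -> seq X -> 'I_n -> R) (eps lam : nat -> R) (T : set ('I_n -> R)) :
  (0 < #|X|)%N -> (forall j, 0 < lam j) -> (forall j, 0 <= eps j) ->
  m 0%N = 0%N ->
  (forall v, T v -> forall j, exists c : (m j).-tuple X,
     forall t, `|v t - h j c t| <= eps j) ->
  exists2 Psi, (forall s v, T v -> signsum s v <= Psi s) &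
    signmean Psi <= n%:R * eps J + \sum_(j < J)
      ((m j.+1 + m j)%:R * ln #|X|%:R / lam j +
       2 * lam j * n%:R * (eps j.+1 + eps j) ^+ 2).
Proof.
move=> X0 lam0 eps0 m0 Th.
pose P j := ((m j.+1).-tuple X * (m j).-tuple X)%type.
(* Cutting large coordinates to 0 makes [massart] applicable to all pairs of words; pairs that
   approximate a common [v] are left unchanged. *)
pose D j (p : P j) t :=
  let x := h j.+1 p.1 t - h j p.2 t in
  if `|x| <= eps j.+1 + eps j then x else 0.
have cardP j : #|{: P j}| = (#|X| ^ (m j.+1 + m j))%N.
  by rewrite card_prod !card_tuple expnD.
have massartD (j : 'I_J) : exists Psi,
    (forall s p, signsum s (@D j p) <= Psi s) /\
    signmean Psi <= (m j.+1 + m j)%:R * ln #|X|%:R / lam j +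
       2 * lam j * n%:R * (eps j.+1 + eps j) ^+ 2.
  have [||//|Psi ? le] := @massart (P j) (@D j) (eps j.+1 + eps j) (lam j).
  - by rewrite cardP expn_gt0 X0.
  - by move=> p t; rewrite /D; case: ifP => // _; rewrite normr0 addr_ge0.
  exists Psi; split=> //; move: le; rewrite cardP natrX lnXn ?ltr0n//.
  by rewrite -[_ *+ (_ + _)]mulr_natl.
have [Psi HPsi] := choice massartD.
(* Since [m 0 = 0], all chains start at the one vector [h 0 [::]], whose sign sum has mean zero. *)
exists (fun s => n%:R * eps J + \sum_(j < J) Psi j s + signsum s (h 0%N [::])).
  move=> s v Tv; pose c j := projT1 (cid (Th v Tv j)).
  have cP j t : `|v t - h j (c j) t| <= eps j := projT2 (cid (Th v Tv j)) t.
  have c0 : tval (c 0%N) = [::].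
    by apply/eqP; rewrite -size_eq0 size_tuple m0.
  have -> : signsum s v = signsum s (fun t => v t - h J (c J) t) +
      \sum_(j < J) (signsum s (h j.+1 (c j.+1)) - signsum s (h j (c j))) +
      signsum s (h 0%N (c 0%N)).
    rewrite -(big_mkord xpredT (fun j =>
      signsum s (h j.+1 (c j.+1)) - signsum s (h j (c j)))).
    rewrite (telescope_sumr (fun j => signsum s (h j (c j))))//.
    rewrite signsumB/=; ring.
  rewrite c0 lerD2r lerD ?signsum_le//; apply: ler_sum => j _.
  rewrite -signsumB; apply: le_trans ((HPsi j).1 s (c j.+1, c j)).
  rewrite le_eqVlt; apply/orP; left; apply/eqP; apply: eq_bigr => t _.
  rewrite /D/= ifT//.
  have := cP j.+1 t; have := cP j t; rewrite !ler_norml; lra.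
rewrite !signmeanD signmean_cst signmean_signsum addr0 lerD2l signmean_sum.
by apply: ler_sum => j _; exact: (HPsi j).2.
Qed.

End signs.

(** * Sparse approximation by the perceptron *)

Section perceptron.
Context (R : realType) (Q E : finType) (z : E -> Q -> R).
Implicit Types (u : Q -> R) (e : E).

Definition fdot (u v : Q -> R) : R := \sum_q u q * v q.

Lemma fdot_subl (u v w : Q -> R) (a : R) :
  fdot (fun q => u q - a * v q) w = fdot u w - a * fdot v w.
Proof.
rewrite /fdot mulr_sumr -sumrB; apply: eq_bigr => q _; ring.
Qed.

Lemma fdotC (u v : Q -> R) : fdot u v = fdot v u.
Proof. by apply: eq_bigr => q _; rewrite mulrC. Qed.

(* The word [c] stands for the sum of the vectors [+- eta z_e'], [None] being a
   padding letter; this is the inner product of that sum with [z e]. *)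
Definition updates_fdot (eta : R) (c : seq (option (E * bool))) e : R :=
  \sum_(a <- c) if a is Some (e', b) then sgb R b * eta * fdot (z e') (z e)
                else 0.

(* Perceptron: as long as some feature is badly approximated, a step of length
   [eps / 2] along it decreases the squared norm of the residual by at least
   [eps ^+ 2 / 2]. *)
Lemma perceptron_cover (eps : R) (m : nat) u :
  0 < eps -> (forall e, fdot (z e) (z e) <= 2) ->
  fdot u u <= m%:R * (eps ^+ 2 / 2) ->
  exists c : m.-tuple (option (E * bool)), forall e,
    `|fdot u (z e) - updates_fdot (eps / 2) c e| <= eps.
Proof.
move=> eps0 z2.
have step (v : Q -> R) e : eps < `|fdot v (z e)| -> exists b,
    let v' := fun q => v q - sgb R b * (eps / 2) * z e q in
    fdot v' v' <= fdot v v - eps ^+ 2 / 2.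
  move=> ve; exists (fdot v (z e) < 0) => /=; set b := _ < 0.
  have vb : sgb R b * fdot v (z e) = `|fdot v (z e)|.
    by rewrite sgbE /b; case: ltP => [/ltr0_norm ->|/ger0_norm ->]; lra.
  have b2 : sgb R b ^+ 2 = 1 by rewrite sgbE; case: ifP => _; ring.
  rewrite fdot_subl (fdotC v) (fdotC (z e)) !fdot_subl (fdotC (z e) v).
  have := z2 e; have : 0 < eps ^+ 2 by rewrite exprn_gt0.
  set V := fdot v v; set Z := fdot (z e) (z e) => e2 Z2.
  (* The cross term gains more than [eps^2], and the quadratic term costs at most [eps^2 / 2]
     because [Z <= 2]. *)
  rewrite (_ : _ - _ = V - eps * (sgb R b * fdot v (z e)) +
                       sgb R b ^+ 2 * (eps ^+ 2 / 4) * Z); last by field.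
  rewrite vb b2; nra.
elim: m u => [|m IHm] u um;
    (have [ue|] := pselect (forall e, `|fdot u (z e)| <= eps)).
- by exists [tuple]; move=> e; rewrite /updates_fdot big_nil subr0.
(* With no step left the squared norm is at most 0, and a correction would make it negative. *)
- move=> /existsNP[e /negP]; rewrite -ltNge => /step[b] /=.
  set v' := fun q => _ => le; exfalso.
  have : 0 <= fdot v' v' by apply: sumr_ge0 => q _; rewrite -expr2 sqr_ge0.
  have : 0 < eps ^+ 2 by rewrite exprn_gt0.
  move: um; rewrite mul0r; lra.
- exists (nseq_tuple m.+1 None) => e.
  by rewrite /updates_fdot big_nseq iter_addr addr0 mul0rn subr0.
move=> /existsNP[e /negP]; rewrite -ltNge => /step[b] /=.
set v' := fun q => _ => le.
have /IHm[c cP] : fdot v' v' <= m%:R * (eps ^+ 2 / 2).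
  by move: um; rewrite -natr1; lra.
exists [tuple of Some (e, b) :: c] => e'.
rewrite /updates_fdot big_cons opprD addrA -fdot_subl; exact: cP.
Qed.

End perceptron.

(** * The maximum and the hinge loss as contractions *)

Lemma max_agg_ge (R : realType) (k : nat) (a : 'I_k.+1 -> R) i :
  a i <= max_agg a.
Proof. exact: le_bigmax. Qed.

Lemma max_agg_le (R : realType) (k : nat) (a : 'I_k.+1 -> R) (c : R) :
  (forall i, a i <= c) -> max_agg a <= c.
Proof. by move=> ac; apply: bigmax_le. Qed.

Lemma max_agg_ex (R : realType) (k : nat) (a : 'I_k.+1 -> R) :
  exists i, max_agg a = a i.
Proof.
apply: (big_ind (fun y => exists i, y = a i)); first by exists ord0.
  by move=> _ _ [i ->] [j ->]; rewrite /Num.max; case: ifP; [exists j|exists i].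
by move=> i _; exists i.
Qed.

Lemma max_agg_lip (R : realType) (k : nat) (a b : 'I_k.+1 -> R) (c : R) :
  (forall i, `|a i - b i| <= c) -> `|max_agg a - max_agg b| <= c.
Proof.
move=> ab; have ab' i : - c <= a i - b i <= c by rewrite -ler_norml.
rewrite ler_norml; apply/andP; split.
  rewrite lerBrDr -lerBrDl opprK; apply: max_agg_le => i.
  by have := max_agg_ge a i; have /andP[] := ab' i; lra.
rewrite lerBlDr; apply: max_agg_le => i.
by have := max_agg_ge b i; have /andP[] := ab' i; lra.
Qed.

Lemma hinge_lip (R : realType) (b : bool) (x y c : R) : `|x - y| <= c ->
  `|Num.max 0 (1 - sgb R b * x) - Num.max 0 (1 - sgb R b * y)| <= c.
Proof.
rewrite sgbE !ler_norml => /andP[]; case: b;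
 (case: (leP 0 (1 - _ * x)); case: (leP 0 (1 - _ * y)));
 by move=> *; apply/andP; split; lra.
Qed.

(** * Euclidean inner products and block vectors *)

Lemma dotp_row_mx (R : realType) (d1 d2 : nat) (a c : 'rV[R]_d1)
    (b e : 'rV[R]_d2) :
  dotp (row_mx a b) (row_mx c e) = dotp a c + dotp b e.
Proof.
rewrite /dotp big_split_ord/=; congr (_ + _); apply: eq_bigr => i _.
  by rewrite !row_mxEl.
by rewrite !row_mxEr.
Qed.

Lemma dotp_const1 (R : realType) (a b : R) :
  dotp (const_mx a : 'rV_1) (const_mx b) = a * b.
Proof. by rewrite /dotp big_ord1 !mxE. Qed.

Lemma dotp_ge0 (R : realType) (d : nat) (w : 'rV[R]_d) : 0 <= dotp w w.
Proof. by apply: sumr_ge0 => j _; rewrite -expr2 sqr_ge0. Qed.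

Lemma enorm_le (R : realType) (d : nat) (w : 'rV[R]_d) (c : R) :
  enorm w <= c -> dotp w w <= c ^+ 2.
Proof.
move=> wc; have c0 : 0 <= c by apply: le_trans wc; exact: sqrtr_ge0.
by rewrite -(sqr_sqrtr (dotp_ge0 w)) lerXn2r// nnegrE sqrtr_ge0.
Qed.

(** Cauchy-Schwarz, by expanding the squared norm of [w - s c x] for [s = 1] and [s = -1]. *)
Lemma norm_dotp_le (R : realType) (d : nat) (w x : 'rV[R]_d) (c : R) : 0 < c ->
  dotp w w <= c ^+ 2 -> dotp x x <= 1 -> `|dotp w x| <= c.
Proof.
move=> c0 wc x1.
have E (s : R) : s ^+ 2 = 1 ->
    0 <= dotp w w + c ^+ 2 * dotp x x - 2 * c * (s * dotp w x).
  move=> s2; rewrite /dotp !mulr_sumr -big_split -sumrB/= sumr_ge0// => j _.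
  rewrite (_ : _ - _ = w 0 j ^+ 2 + c ^+ 2 * x 0 j ^+ 2 -
                       2 * c * s * w 0 j * x 0 j); last by ring.
  have := sqr_ge0 (w 0 j - s * c * x 0 j); rewrite sqrrB !exprMn s2; nra.
have := E 1 (expr1n _ _); have := E (-1) (etrans (sqrrN 1) (expr1n _ _)) => {E}.
have c2 : c ^+ 2 * dotp x x <= c ^+ 2 by rewrite ler_piMr// sqr_ge0.
rewrite ler_norml => h1 h2; apply/andP; split; nra.
Qed.

(** A family of vectors is treated as one vector indexed by pairs; testing it against a vector
    supported on block [i] recovers the [i]-th inner product. *)
Lemma fdot_row (R : realType) (I J : finType) (U : I -> J -> R) (y : J -> R) i :
  fdot (fun q : I * J => U q.1 q.2) (fun q => (q.1 == i)%:R * y q.2) =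
  \sum_j U i j * y j.
Proof.
rewrite /fdot -(pair_bigA _ (fun i' j => U i' j * ((i' == i)%:R * y j)))/=.
rewrite (bigD1 i)//= [X in _ + X]big1 ?addr0; last first.
  by move=> i' /negbTE ->; rewrite big1// => j _; rewrite mul0r mulr0.
by apply: eq_bigr => j _; rewrite eqxx mul1r.
Qed.

(** * Logarithmic estimates *)

Lemma ln2_ge (R : realType) : 1 / 2 <= ln (2 : R).
Proof.
rewrite -ler_expR lnK ?posrE//.
have := expR_ge1Dx (- (1 / 2) : R); rewrite expRN => h.
have e0 := expR_gt0 (1 / 2 : R).
have : (1 / 2) * expR (1 / 2 : R) <= 1.
  rewrite -[leRHS](mulVf (lt0r_neq0 e0)) ler_pM2r//; lra.
lra.
Qed.

Lemma Log_ge1 (R : realType) (x : R) : 1 <= Log x.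
Proof.
rewrite -[leLHS](expRK 1) ler_ln ?posrE ?expR_gt0 ?lt_max ?expR_gt0//.
by rewrite le_max lexx.
Qed.

Lemma ln_le_Log (R : realType) (x : R) : 0 < x -> ln x <= Log x.
Proof.
by move=> x0; rewrite ler_ln ?posrE ?lt_max ?expR_gt0// le_max lexx orbT.
Qed.

(** If [up_log 2 n = j + 1] then [2^j < n], so [j <= 2 L] by [ln2_ge], and the remaining 1 is at
    most [2 L]. *)
Lemma up_log2_le (R : realType) (n : nat) (L : R) :
  (0 < n)%N -> ln n%:R <= L -> 1 / 2 <= L -> (up_log 2 n)%:R <= 4 * L.
Proof.
move=> n0 nL L2; have [n1|n1] := leqP n 1.
  by rewrite (eqP (_ : up_log 2 n == 0%N)) ?up_log_eq0//; lra.
have /andP[] := up_log_bounds (isT : (1 < 2)%N) n1.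
have : (0 < up_log 2 n)%N by rewrite up_log_gt0.
case: (up_log 2 n) => // j _ /= jn _.
have : ln ((2 ^ j)%:R : R) <= ln n%:R.
  by rewrite ler_ln ?posrE ?ltr0n ?expn_gt0// ler_nat ltnW.
rewrite natrX lnXn// -[_ *+ j]mulr_natl -natr1 => h.
have := ln2_ge R; have : 0 <= j%:R :> R by []; nra.
Qed.

(** The argument counts the perceptron letters: signed features and the padding. As
    [2 a + 1 <= a^3], its logarithm is at most [3 ln a + ln k.+1]; then [ln a >= 1/2] and [Log >= 1]
    turn the sum into a product. *)
Lemma ln_codes_le (R : realType) (n k : nat) (a : R) :
  2 <= a -> n%:R <= a ->
  ln ((k.+1 * n * 2).+1%:R : R) <= 5 * (ln a * Log k.+1%:R).
Proof.
move=> a2 na; have a0 : 0 < a by lra.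
have h1 : (k.+1 * n * 2).+1%:R <= a ^+ 3 * k.+1%:R :> R.
  have K1 : 1 <= k.+1%:R :> R by rewrite ler1n.
  have N0 : 0 <= n%:R :> R by [].
  rewrite -[X in X <= _]natr1 !natrM; set N := n%:R in na N0 *.
  set K := k.+1%:R in K1 *.
  have : 0 <= (a - 2) * (a ^+ 2 + 2 * a + 2).
    have := sqr_ge0 a; move=> ?; apply: mulr_ge0; lra.
  move=> a3; have {}a3 : 2 * N + 1 <= a ^+ 3 by lra.
  have : 0 <= (a ^+ 3 - (2 * N + 1)) * K by rewrite mulr_ge0//; lra.
  lra.
have hln : ln ((k.+1 * n * 2).+1%:R : R) <= 3 * ln a + ln k.+1%:R.
  have a3 : 0 < a ^+ 3 by rewrite exprn_gt0.
  have -> : 3 * ln a = ln (a ^+ 3) by rewrite lnXn// mulr_natl.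
  by rewrite -lnM ?posrE ?ltr0Sn// ler_ln ?posrE ?ltr0Sn// mulr_gt0// ltr0Sn.
apply: (le_trans hln).
have := ln_le_Log (ltr0Sn R k); have := Log_ge1 (k.+1%:R : R).
have : ln 2 <= ln a by rewrite ler_ln ?posrE.
have := ln2_ge R; set L := ln a; set G := Log _ => l2 L2 G1 KG.
have : 0 <= L * (G - 1) by rewrite mulr_ge0//; lra.
have : 0 <= (L - 1 / 2) * G by rewrite mulr_ge0//; lra.
lra.
Qed.

(** * The bound for a fixed sample *)

Section lipschitz_affine.
Context (R : realType) (d k n : nat) (r : 'I_k.+1 -> R) (x : 'I_n -> 'rV[R]_d)
  (phi : 'I_n -> ('I_k.+1 -> R) -> R)
  (x1 : forall t, dotp (x t) (x t) <= 1)
  (phi_lip : forall t a b c, (forall i, `|a i - b i| <= c) ->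
    `|phi t a - phi t b| <= c).

Let rmax := max_agg r.
Let S := \sum_(i < k.+1) r i ^+ 2.

(** The point [x_t], extended by a coordinate 1 for the bias and placed in block [i]: its inner
    product with all parameters together is [w_i . x_t + b_i]. *)
Definition feature (e : 'I_k.+1 * 'I_n) (q : 'I_k.+1 * 'I_(1 + d)) : R :=
  (q.1 == e.1)%:R * row_mx (const_mx 1) (x e.2) 0 q.2.

Lemma feature_le2 e : fdot (feature e) (feature e) <= 2.
Proof.
rewrite (fdot_row (fun i j => (i == e.1)%:R * row_mx (const_mx 1) (x e.2) 0 j)).
rewrite eqxx; under eq_bigr do rewrite mul1r.
rewrite -/(dotp _ _) dotp_row_mx dotp_const1.
by have := x1 e.2; lra.
Qed.

(** Weights and biases each contribute at most [S] to the squared norm, hence [eps^2 / 4] where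
    [perceptron_cover] has [eps^2 / 2]. *)
Lemma affine_perceptron_cover (w : 'I_k.+1 -> 'rV[R]_d) (b : 'I_k.+1 -> R)
    (eps : R) (m : nat) :
  0 < eps -> S <= m%:R * (eps ^+ 2 / 4) ->
  (forall i, Num.max (enorm (w i)) `|b i| <= r i) ->
  exists c : m.-tuple (option ('I_k.+1 * 'I_n * bool)), forall i t,
    `|dotp (w i) (x t) + b i - updates_fdot feature (eps / 2) c (i, t)| <= eps.
Proof.
move=> eps0 Sm wb; pose U i := row_mx (const_mx (b i) : 'rV_1) (w i).
pose u (q : 'I_k.+1 * 'I_(1 + d)) := U q.1 0 q.2.
have uu : fdot u u <= 2 * S.
  rewrite /fdot -(pair_bigA _ (fun i j => U i 0 j * U i 0 j))/= mulr_sumr.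
  apply: ler_sum => i _; rewrite -/(dotp _ _) dotp_row_mx dotp_const1.
  have := wb i; rewrite ge_max => /andP[/enorm_le wr br].
  suff : b i * b i <= r i ^+ 2 by lra.
  rewrite -expr2 -(real_normK (num_real (b i))) lerXn2r// nnegrE//.
  exact: le_trans br.
have [|c cP] := perceptron_cover eps0 feature_le2 (u := u) (m := m).
  by apply: le_trans uu _; lra.
exists c => i t; have := cP (i, t); congr (`|_ - _| <= _).
rewrite (fdot_row (fun i j => U i 0 j)) -/(dotp _ _) dotp_row_mx dotp_const1.
by rewrite mulr1 addrC.
Qed.

(** An abstract contraction [phi] serves both classes: a cover of the affine values is carried
    through it at the same scale. *)
Lemma signmean_lipschitz_affine : 1 <= rmax -> 2 <= rmax * n%:R ->
  exists2 Psi, (forall s (w : 'I_k.+1 -> 'rV[R]_d) (b : 'I_k.+1 -> R),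
      (forall i, Num.max (enorm (w i)) `|b i| <= r i) ->
      signsum s (fun t => phi t (fun i => dotp (w i) (x t) + b i)) <= Psi s) &
    signmean Psi <= n%:R * (400 * Num.sqrt (Log k.+1%:R *
      (ln (rmax * n%:R)) ^+ 3 * rmax ^+ 2 * S / n%:R)).
Proof.
move=> r1 rn2.
have n0 : (0 < n)%N by case: n rn2 => //; rewrite mulr0; lra.
have n1 : 1 <= n%:R :> R by rewrite ler1n.
have nrn : n%:R <= rmax * n%:R by rewrite ler_peMl.
set L := ln (rmax * n%:R); set G := Log _.
have L2 : 1 / 2 <= L.
  by apply: le_trans (ln2_ge R) _; rewrite ler_ln ?posrE//; lra.
have nL : ln n%:R <= L by rewrite ler_ln ?posrE//; lra.
have G1 : 1 <= G by exact: Log_ge1.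
have Sr : rmax ^+ 2 <= S.
  have [i ->] : exists i, rmax = r i := max_agg_ex r.
  by rewrite /S (bigD1 i)//= lerDl sumr_ge0// => *; rewrite sqr_ge0.
have r21 : 1 <= rmax ^+ 2 by rewrite expr_ge1//; lra.
pose X := option ('I_k.+1 * 'I_n * bool).
have cardX : #|{: X}| = (k.+1 * n * 2).+1.
  by rewrite card_option !card_prod !card_ord card_bool.
have HX : ln #|{: X}|%:R <= 5 * (L * G) by rewrite cardX; exact: ln_codes_le.
pose H := 5 * (L * G).
have H0 : 0 < H by rewrite /H; nra.
(* Scale [2 rmax / 2^j] needs [4^j S / rmax^2] corrections; rounding up costs at most a factor 2
   since [rmax^2 <= S]. *)
pose m0 := (Num.trunc (S / rmax ^+ 2)).+1.
have rr0 : 0 < rmax ^+ 2 by lra.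
have m0S : S <= m0%:R * rmax ^+ 2.
  by rewrite -ler_pdivrMr//; apply/ltW/truncnS_gt.
have m02S : m0%:R * rmax ^+ 2 <= 2 * S.
  have : (Num.trunc (S / rmax ^+ 2))%:R <= S / rmax ^+ 2.
    by rewrite truncn_le// divr_ge0//; lra.
  by rewrite ler_pdivlMr// /m0 -natr1; lra.
pose eps j : R := 2 * rmax / 2 ^+ j.
(* At scale [eps 0] the zero vector is good enough, so one code suffices. *)
pose m j : nat := if j is 0%N then 0%N else (4 ^ j * m0)%N.
(* [mu] balances the two terms of [massart] at every scale. *)
pose mu : R := Num.sqrt (m0%:R * H / (n%:R * rmax ^+ 2)).
pose lam j : R := 4 ^+ j * mu.
have mu0 : 0 < mu.
  by rewrite sqrtr_gt0 divr_gt0// mulr_gt0// ?ltr0n//; lra.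
pose K : R := mu * (n%:R * rmax ^+ 2).
have nr0 : 0 < n%:R * rmax ^+ 2 by rewrite mulr_gt0// ltr0n.
have muK : mu * K = m0%:R * H.
  rewrite mulrA -expr2 sqr_sqrtr ?divfK ?gt_eqF// divr_ge0// ?ltW//.
  by rewrite mulr_gt0// ltr0n.
have KK : K ^+ 2 = m0%:R * rmax ^+ 2 * (H * n%:R).
  by rewrite {1}/K expr2 -mulrA mulrCA muK; ring.
pose T := [set v : 'I_n -> R | exists w : 'I_k.+1 -> 'rV[R]_d,
  exists2 b : 'I_k.+1 -> R, (forall i, Num.max (enorm (w i)) `|b i| <= r i) &
  v = fun t => phi t (fun i => dotp (w i) (x t) + b i)].
pose h j (c : seq X) t :=
  phi t (fun i => updates_fdot feature (eps j / 2) c (i, t)).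
have eps0 j : 0 < eps j by rewrite divr_gt0 ?exprn_gt0//; lra.
have [||||_ [w [b wb ->]] j|Psi HPsi Psi_le] :=
    @chaining R n X (up_log 2 n) m h eps lam T.
- by rewrite cardX.
- by move=> j; rewrite mulr_gt0// exprn_gt0.
- by move=> j; apply/ltW.
- by [].
- case: j => [|j].
    exists [tuple] => t; apply: phi_lip => i.
    rewrite /updates_fdot big_nil subr0 /eps expr0 divr1.
    have := wb i; rewrite ge_max => /andP[/enorm_le wr br].
    have ri : r i <= rmax := max_agg_ge r i.
    have ri0 : 0 <= r i by apply: le_trans br.
    have : `|dotp (w i) (x t)| <= rmax.
      apply: norm_dotp_le => //; first lra.
      by apply: le_trans wr _; rewrite lerXn2r ?nnegrE//; lra.
    by have := ler_normD (dotp (w i) (x t)) (b i); lra.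
  have [//||//|c cP] := @affine_perceptron_cover w b (eps j.+1) (m j.+1).
    rewrite /m natrM natrX /eps (_ : _ * _ = m0%:R * rmax ^+ 2)//.
    rewrite [4](_ : _ = 2 ^+ 2); last by ring.
    by rewrite -exprM mulnC exprM; field; rewrite expf_neq0.
  by exists c => t; apply: phi_lip => i; exact: cP.
exists Psi.
  by move=> s w b wb; apply: HPsi; exists w, b.
apply: le_trans Psi_le _.
have K0 : 0 < K by rewrite mulr_gt0.
(* The powers of 4 cancel. The word lengths add up to at most [5 * 4^j * m0], giving [5 K]; the
   scales add up to [3 rmax / 2^j], giving [2 * 9 K]. *)
have term (j : nat) : (m j.+1 + m j)%:R * ln #|{: X}|%:R / lam j +
       2 * lam j * n%:R * (eps j.+1 + eps j) ^+ 2 <= 23 * K.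
  have j0 : 0 < 4 ^+ j :> R by rewrite exprn_gt0.
  have mj : (m j.+1 + m j)%:R <= 5 * (4 ^+ j * m0%:R) :> R.
    have mj : (m j)%:R <= 4 ^+ j * m0%:R :> R.
      by case: j {j0} => [|j]; rewrite /m ?natrM ?natrX// mulr_ge0.
    by rewrite natrD {1}/m natrM natrX exprS; lra.
  have <- : 5 * (4 ^+ j * m0%:R) * H / lam j + 18 * K = 23 * K.
    have -> : m0%:R = mu * K / H by rewrite muK mulfK// gt_eqF.
    by rewrite /lam; field; rewrite !gt_eqF.
  apply: lerD.
    rewrite ler_pM2r ?invr_gt0 ?mulr_gt0//; apply: ler_pM => //.
    by rewrite ln_ge0// cardX ler1n.
  rewrite le_eqVlt; apply/orP; left; apply/eqP.
  have p4 : 4 ^+ j = (2 ^+ j) ^+ 2 :> R.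
    by rewrite exprAC; congr (_ ^+ j); ring.
  have p0 : 2 ^+ j != 0 :> R by rewrite expf_neq0.
  by rewrite /lam /K /eps (exprS 2 j) p4; move: (2 ^+ j) p0 => p p0; field.
have sumle : \sum_(j < up_log 2 n) ((m j.+1 + m j)%:R * ln #|{: X}|%:R / lam j +
       2 * lam j * n%:R * (eps j.+1 + eps j) ^+ 2) <= 4 * L * (23 * K).
  apply: (@le_trans _ _ (\sum_(j < up_log 2 n) 23 * K)); first exact: ler_sum.
  rewrite sumr_const card_ord -[_ *+ up_log 2 n]mulr_natl.
  rewrite ler_wpM2r//; first nra.
  exact: up_log2_le.
(* The chain stops once [2^J >= n], where the residual is at most [2 rmax]. *)
have epsle : n%:R * eps (up_log 2 n) <= 2 * Num.sqrt S.
  have nJ : n%:R <= 2 ^+ up_log 2 n :> R by rewrite -natrX ler_nat up_logP.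
  have rS : rmax <= Num.sqrt S.
    rewrite -[leLHS]ger0_norm; last by lra.
    by rewrite -sqrtr_sqr ler_sqrt//; lra.
  rewrite /eps mulrA ler_pdivrMr ?exprn_gt0// mulrCA -[leRHS]mulrA.
  rewrite ler_pM2l// mulrC; apply: ler_pM => //; lra.
(* [n^2] times the radicand of the goal. *)
set Q := G * L ^+ 3 * rmax ^+ 2 * S * n%:R.
have L3 : 1 <= 8 * L ^+ 3.
  have : (1 / 2) ^+ 3 <= L ^+ 3 by rewrite lerXn2r ?nnegrE//; lra.
  by rewrite !exprS expr0; lra.
have SQ : S <= 8 * Q.
  have -> : 8 * Q = (G * (8 * L ^+ 3) * (rmax ^+ 2 * n%:R)) * S.
    by rewrite /Q; ring.
  have A1 : 1 <= G * (8 * L ^+ 3) by exact: mulr_ege1.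
  have B1 : 1 <= rmax ^+ 2 * n%:R by exact: mulr_ege1.
  by rewrite ler_peMl//; [lra|exact: mulr_ege1].
have Q0 : 0 <= Q by lra.
have {}SQ : Num.sqrt S <= 3 * Num.sqrt Q.
  rewrite -ler_sqr ?nnegrE ?mulr_ge0 ?sqrtr_ge0//.
  by rewrite exprMn !sqr_sqrtr//; lra.
(* The cube of [L] arises here: [L^2] from the number of scales, and one [L] from the entropy inside
   [K^2]. *)
have KQ : L * K <= 4 * Num.sqrt Q.
  rewrite -ler_sqr ?nnegrE ?mulr_ge0 ?sqrtr_ge0//; try lra.
  rewrite exprMn (exprMn _ 4) sqr_sqrtr// KK /H.
  have -> : L ^+ 2 * (m0%:R * rmax ^+ 2 * (5 * (L * G) * n%:R)) =
      m0%:R * rmax ^+ 2 * (5 * (G * L ^+ 3) * n%:R) by ring.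
  have GLn : 0 <= G * L ^+ 3 * n%:R by rewrite !mulr_ge0 ?exprn_ge0//; lra.
  apply: (@le_trans _ _ (2 * S * (5 * (G * L ^+ 3) * n%:R))).
    by rewrite ler_wpM2r//; lra.
  have : 0 <= G * L ^+ 3 * n%:R * (S * (rmax ^+ 2 - 1)).
    by rewrite mulr_ge0// mulr_ge0//; lra.
  have : 0 <= G * L ^+ 3 * n%:R * S by rewrite mulr_ge0//; lra.
  rewrite /Q; lra.
have -> : n%:R * (400 * Num.sqrt (G * L ^+ 3 * rmax ^+ 2 * S / n%:R)) =
    400 * Num.sqrt Q.
  rewrite mulrCA -{1}(ger0_norm (ler0n R n)) -sqrtr_sqr -sqrtrM ?sqr_ge0//.
  by congr (_ * Num.sqrt _); rewrite /Q; field; rewrite pnatr_eq0 -lt0n.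
(* The total is [2 * 3 + 4 * 23 * 4 = 374], rounded up to 400. *)
by apply: le_trans (lerD epsle sumle) _; have := sqrtr_ge0 Q; lra.
Qed.

End lipschitz_affine.

(** * From a fixed sample to the expectation *)

Import HBNNSimple.

(** The integrand will be a supremum over an infinite class, so [f] is arbitrary: the integral of
    its positive part is a supremum over simple functions below it, each bounded by [c]. *)
Lemma integral_le_cst (R : realType) (dT : measure_display)
    (T : measurableType dT) (P : probability T R) (f : T -> \bar R) (c : R) :
  0 <= c -> (forall x, (f x <= c%:E)%E) -> (\int[P]_x f x <= c%:E)%E.
Proof.
move=> c0 fc; rewrite integralE.
apply: (@le_trans _ _ (\int[P]_x (f^\+%E x))%E).
  by rewrite geeDl// leeNl oppe0 integral_ge0.
rewrite ge0_integralTE//; apply: ge_ereal_sup => _ [h /= hf <-].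
rewrite -integralT_nnsfun; apply: (@le_trans _ _ (\int[P]_x (cst c%:E x))%E).
  apply: ge0_le_integral => //.
  - by move=> x _; rewrite lee_fin fun_ge0.
  - exact/measurable_realfun.measurable_EFinP.
  - move=> x _; apply: le_trans (hf x) _; rewrite funeposE.
    by rewrite ge_max fc lee_fin.
by rewrite integral_cst// [X in (_ * X)%E]probability_setT mule1.
Qed.

(** The majorant [Psi] stands in for the supremum, so that the fixed-sample argument stays within
    real numbers. *)
Lemma rademacher_le (R : realType) (dW : measure_display)
    (W : measurableType dW) (D : probability W R) (F : set (W -> R)) (n : nat)
    (c : R) :
  (0 < n)%N -> 0 <= c ->
  (forall w : n.-tuple W, exists2 Psi,
     (forall s f, F f -> signsum s (fun t => f (tnth w t)) <= Psi s) &
     signmean Psi <= n%:R * c) ->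
  (rademacher D F n <= c%:E)%E.
Proof.
move=> n0 c0 FPsi; apply: integral_le_cst => // w.
have [Psi FP Pc] := FPsi w.
have n0' : 0 < n%:R :> R by rewrite ltr0n.
apply: (@le_trans _ _ (((2 ^+ n)^-1)%:E *
   \sum_(s : {ffun 'I_n -> bool}) (n%:R^-1 * Psi s)%:E)%E).
  rewrite lee_pmul2l// ?lte_fin ?invr_gt0 ?exprn_gt0//.
  apply: lee_sum => s _; apply: ge_ereal_sup => _ [f Ff <-].
  by rewrite lee_fin ler_pM2l ?invr_gt0//; exact: FP.
rewrite sumEFin -EFinM lee_fin -mulr_sumr mulrCA -/(signmean Psi).
by rewrite ler_pdivrMl.
Qed.

(** At [rmax * n = 1] the logarithm, hence the bound, vanishes, while an affine class can have
    positive complexity. Affine complexity has degree 1 in the radii and the bound degree 2 up to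
    the logarithm, so small [rmax] is excluded. *)
Theorem corollary5 (R : realType) :
  exists2 C : R, 0 < C &
    forall (d k n : nat) (r : 'I_k.+1 -> R),
      let rmax := max_agg r in
      let bound := C * Num.sqrt (Log k.+1%:R * (ln (rmax * n%:R)) ^+ 3 *
                     rmax ^+ 2 * (\sum_(i < k.+1) r i ^+ 2) / n%:R) in
      1 <= rmax -> 2 <= rmax * n%:R ->
      (forall D : probability (borel_eball R d) R,
         (rademacher D (Gmax (fun i => @affine_class R d (r i))) n
            <= bound%:E)%E)
      /\
      (forall D : probability (borel_eball R d * bool)%type R,
         (rademacher D (Gmax (fun i => @hinge_class R d (r i))) n
            <= bound%:E)%E).
Proof.
exists 400; first by [].
move=> d k n r rmax bound r1 rn2.
have n0 : (0 < n)%N.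
  by rewrite lt0n; apply/eqP => n0; move: rn2; rewrite n0 mulr0; lra.
have bound0 : 0 <= bound by rewrite mulr_ge0// sqrtr_ge0.
have ball1 (x : eball R d) : dotp (sval x) (sval x) <= 1.
  by rewrite -(expr1n R 2); apply: enorm_le; case: x.
split=> D; apply: rademacher_le => // w.
- have [||Psi HPsi Pb] := @signmean_lipschitz_affine R d k n r
    (fun t => sval (tnth w t)) (fun=> @max_agg R k) _ _ r1 rn2.
  + by move=> t; exact: ball1.
  + by move=> t a b c; exact: max_agg_lip.
  exists Psi => // s _ [f fA ->].
  have /choice[wb wbP] i : exists wb : 'rV[R]_d * R,
      Num.max (enorm wb.1) `|wb.2| <= r i /\
      f i = fun x => dotp wb.1 (sval x) + wb.2.
    by have [v [b vb fi]] := fA i; exists (v, b).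
  have := HPsi s (fun i => (wb i).1) (fun i => (wb i).2) (fun i => (wbP i).1).
  congr (signsum s _ <= _); apply/funext => t; congr max_agg.
  by apply/funext => i; rewrite (wbP i).2.
(* The labels enter only through [phi]; the features see only the points. *)
- have [||Psi HPsi Pb] := @signmean_lipschitz_affine R d k n r
    (fun t => sval (tnth w t).1)
    (fun t a => max_agg (fun i => Num.max 0 (1 - sgb R (tnth w t).2 * a i)))
    _ _ r1 rn2.
  + by move=> t; exact: ball1.
  + by move=> t a b c abc; apply: max_agg_lip => i; exact: hinge_lip.
  exists Psi => // s _ [f fA ->].
  have /choice[wb wbP] i : exists wb : 'rV[R]_d * R,
      Num.max (enorm wb.1) `|wb.2| <= r i /\
      f i = hinge (fun x => dotp wb.1 (sval x) + wb.2).
    by have [_ [v [b vb ->]] <-] := fA i; exists (v, b).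
  have := HPsi s (fun i => (wb i).1) (fun i => (wb i).2) (fun i => (wbP i).1).
  congr (signsum s _ <= _); apply/funext => t; congr max_agg.
  by apply/funext => i; rewrite (wbP i).2.
Qed.
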